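(* Let $e\in R^+$ be any positive root and $\alpha\in\Omega(R^+)$ any weight. (1) If $r(e,\alpha)\geq 0$, then $\Gamma_e^1(\alpha)\neq\emptyset$. Moreover, if $\Gamma_e^0(\alpha)\neq\emptyset$, then for any vertex $\sigma\in\Gamma_e^0(\alpha)$ there is $\tau\in\Gamma_e^1(\alpha)$ such that $\{\sigma,\tau\}$ is an edge of $\Gamma(\alpha)$. (2) If $r(e,\alpha)\leq 0$, then $\Gamma_e^0(\alpha)\neq\emptyset$. Moreover, if $\Gamma_e^1(\alpha)\neq\emptyset$, then for any vertex $\sigma\in\Gamma_e^1(\alpha)$ there is $\tau\in\Gamma_e^0(\alpha)$ such that $\{\sigma,\tau\}$ is an edge of $\Gamma(\alpha)$.
   Context: $R^+$ is the positive root system of a semisimple Lie algebra over $\mathbb C$, $V$ is the real vector space spanned by $R^+$ with a $W$-invariant metric, and $W$ is the Weyl group acting on $V$, the action being written $w*v$. For $e\in R^+$, $r_e\in W$ is the reflection fixing the hyperplane orthogonal to $e$. Basis graph $\Gamma(R^+)$: its vertices are all subsets of $R^+$ (including $\emptyset$); $\{\sigma,\tau\}$ is an edge iff there are $e,e_1,e_2\in R^+$ with $e=e_1+e_2$ such that either $\sigma\setminus\tau=\{e\}$ and $\tau\setminus\sigma=\{e_1,e_2\}$, or $\tau\setminus\sigma=\{e\}$ and $\sigma\setminus\tau=\{e_1,e_2\}$. Weight: $\omega(\sigma)=\varrho-\sum_{e\in\sigma}e$ with $\varrho=\frac12\sum_{e\in R^+}e$; $\Omega(R^+)=\{\omega(\sigma)\mid\sigma\subseteq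 R^+\}$; $\Gamma(\alpha)$ is the full subgraph of $\Gamma(R^+)$ on $\omega^{-1}(\alpha)$. $\Gamma_e^1(\alpha)$ (resp. $\Gamma_e^0(\alpha)$) is the full subgraph of $\Gamma(\alpha)$ consisting of all vertices $\sigma$ with $e\in\sigma$ (resp. $e\notin\sigma$). The index $r(e,\alpha)\in\mathbb Z$ is the integer with $r_e*\alpha-\alpha=r(e,\alpha)e$. *)

(* Defs.v *)
From HB Require Import structures.
From mathcomp Require Import all_boot all_order all_algebra finmap.
From mathcomp Require Import boolp classical_sets reals.

Set Implicit Arguments.
Unset Strict Implicit.
Unset Printing Implicit Defensive.

Import Order.TTheory GRing.Theory Num.Theory.
Local Open Scope ring_scope.

(* The roots of a semisimple complex Lie algebra are encoded as a reduced
   crystallographic root system Phi in the Euclidean space (V, dot); these are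
   exactly the root systems arising from such Lie algebras.  The Weyl group is
   generated by the [reflection dot e], e \in Phi, which are orthogonal for dot,
   so that the W-invariance of the metric is automatic. *)

Section RootSystem.

Variables (R : realType) (V : vectType R) (dot : {dot V for @idfun R}).

Definition reflection (e v : V) : V := v - (2 * dot v e / dot e e) *: e.

Definition root_system (Phi : {fset V}) : Prop :=
  [/\ <<Phi>>%VS = fullv,
      0 \notin Phi,
      forall a b, a \in Phi -> b \in Phi -> reflection a b \in Phi,
      forall a b, a \in Phi -> b \in Phi ->
        2 * dot b a / dot a a \is a Num.int
    & forall (a : V) (c : R), a \in Phi -> c *: a \in Phi ->
        c = 1 \/ c = - 1].

Definition positive_system (Phi Rp : {fset V}) : Prop :=
  [/\ (Rp `<=` Phi)%fset,
      forall a, a \in Phi -> (a \in Rp) (+) (- a \in Rp)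
    & forall a b, a \in Rp -> b \in Rp -> a + b \in Phi -> a + b \in Rp].

(* r(e, alpha), by definite description: the integer is unique as e != 0, and
   it exists for e in Rp and alpha in Omega Rp, so the default 0 is not used. *)
Definition root_index (e alpha : V) : int :=
  xget 0 [set r : int | reflection e alpha - alpha = r%:~R *: e]%classic.

End RootSystem.

Record graph (T : choiceType) := Graph {
  vertices : {fset T};
  edge : T -> T -> Prop }.

Definition full_subgraph (T : choiceType) (G : graph T) (P : pred T) :
    graph T :=
  {| vertices := [fset x in vertices G | P x]%fset;
     edge := fun x y => [/\ edge G x y, P x & P y] |}.

Section BasisGraph.

Variables (R : realType) (V : vectType R) (Rp : {fset V}).

Definition basis_graph : graph {fset V} :=
  {| vertices := fpowerset Rp;
     edge := fun s t =>
       [/\ (s `<=` Rp)%fset, (t `<=` Rp)%fset &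
         exists e e1 e2 : V,
           [/\ e \in Rp, e1 \in Rp, e2 \in Rp, e = e1 + e2 &
             ((s `\` t = [fset e] /\ t `\` s = [fset e1; e2]) \/
              (t `\` s = [fset e] /\ s `\` t = [fset e1; e2]))%fset]] |}.

Definition rho : V := 2^-1 *: \sum_(e <- Rp) e.

Definition weight (s : {fset V}) : V := rho - \sum_(e <- s) e.

Definition Omega : {fset V} := [fset weight s | s in fpowerset Rp]%fset.

Definition Gamma (alpha : V) : graph {fset V} :=
  full_subgraph basis_graph (fun s => weight s == alpha).

Definition Gamma1 (e alpha : V) : graph {fset V} :=
  full_subgraph (Gamma alpha) (fun s => e \in s).

Definition Gamma0 (e alpha : V) : graph {fset V} :=
  full_subgraph (Gamma alpha) (fun s => e \notin s).

End BasisGraph.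

(* Main.v *)
(* Put eps f = -1 for f in sigma and eps f = 1 for f in R^+ \ sigma, and extend
   eps to all roots by eps (- f) = - eps f, so that pairing 4 omega(sigma) with
   the coroot of e gives sum_(f in Phi) eps f <f, e^vee>.  Let e be outside
   sigma.  Whatever the signs of the roots f and f + e, an edge from sigma to
   some tau containing e exists as soon as eps f = 1 and eps (f + e) = -1.  If
   there is no such edge, eps is therefore nondecreasing along e-strings;
   pairing f with r_e f then shows that the sum above is positive (the pair
   e, - e contributes strictly), i.e. r(e, alpha) < 0.  Part (2) follows from
   part (1) by replacing sigma with its complement, which negates the weight. *)
Require Import Defs.
From HB Require Import structures.
From mathcomp Require Import all_boot all_order all_algebra finmap.
From mathcomp Require Import reals.
From mathcomp Require Import boolp classical_sets ring lra zify.

Set Implicit Arguments.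
Unset Strict Implicit.
Unset Printing Implicit Defensive.

Import Order.TTheory GRing.Theory Num.Theory.
Local Open Scope ring_scope.

(** * Sums over a finite set carrying an involution *)

Section FsetSums.

Variables (T : choiceType) (A : {fset T}) (h : T -> T).
Hypothesis h_stable : forall x, x \in A -> h x \in A.
Hypothesis hK : forall x, x \in A -> h (h x) = x.

Lemma sum_reindex_involution (M : zmodType) (F : T -> M) :
  \sum_(x <- A) F (h x) = \sum_(x <- A) F x.
Proof.
rewrite -(big_map h xpredT F); apply/perm_big/uniq_perm => [||x].
- rewrite map_inj_in_uniq ?fset_uniq // => x y Ax Ay hxy.
  by rewrite -(hK Ax) hxy hK.
- exact: fset_uniq.
- apply/mapP/idP => [[y Ay ->]|Ax]; first exact: h_stable.
  by exists (h x); rewrite ?hK //; exact: h_stable.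
Qed.

End FsetSums.

(** Removing one orbit of [h] at a time leaves an [h]-stable set and splits off an integer. The
    induction runs on a bound for the cardinal because an orbit has one or two elements. It serves
    for half-integral terms, as in [rho]. *)
Lemma sum_involution_int (R : archiRealFieldType) (T : choiceType) (h : T -> T)
    (G : T -> R) (A : {fset T}) :
    (forall x, x \in A -> h x \in A) ->
    (forall x, x \in A -> h (h x) = x) ->
    (forall x, x \in A -> G x + G (h x) \is a Num.int) ->
    (forall x, x \in A -> h x = x -> G x \is a Num.int) ->
  \sum_(x <- A) G x \is a Num.int.
Proof.
move: {2}#|` A|%fset (leqnn #|` A|%fset) => n.
elim: n A => [|n IH] A leAn hA hhA GA Gfix.
  by move: leAn; rewrite leqn0 cardfs_eq0 => /eqP ->; rewrite big_seq_fset0.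
have [->|[x Ax]] := fset_0Vmem A; first by rewrite big_seq_fset0.
rewrite (big_fsetD1 x) //=.
have leA1 : (#|` (A `\ x)%fset| <= n)%N.
  by rewrite (cardfsD1 x) Ax add1n ltnS in leAn.
have [hx|hx] := eqVneq (h x) x.
  rewrite rpredD ?Gfix //; apply: IH => // y; rewrite !inE => /andP[yx Ay].
  - rewrite hA // andbT; apply: contra_neq yx => hyx.
    by rewrite -(hhA y) // hyx.
  - exact: hhA.
  - exact: GA.
  - exact: Gfix.
have Ahx : h x \in (A `\ x)%fset by rewrite !inE hx hA.
rewrite (big_fsetD1 (h x)) //= addrA rpredD ?GA //; apply: IH => [|y|y|y|y].
- apply: leq_trans leA1; exact/fsubset_leq_card/fsubD1set.
- rewrite !inE => /and3P[yhx yx Ay].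
  rewrite hA // andbT; apply/andP; split.
    by apply: contra_neq yx => hyx; rewrite -(hhA y) // hyx hhA.
  by apply: contra_neq yhx => hyx; rewrite -(hhA y) // hyx.
- by rewrite !inE => /and3P[_ _]; exact: hhA.
- by rewrite !inE => /and3P[_ _]; exact: GA.
- by rewrite !inE => /and3P[_ _]; exact: Gfix.
Qed.

(** * Reflections and the pairing with a coroot *)

Section Reflections.

Variables (R : realType) (V : vectType R) (dot : {dot V for @idfun R}).
Implicit Types a e f u v : V.

Lemma dotC u v : dot u v = dot v u.
Proof. by rewrite (hermC dot) expr0 mul1r. Qed.

(** The pairing of v with the coroot of e, a Cartan integer when both are roots; it is linear in v
    only. *)
Definition cartan e v : R := 2 * dot v e / dot e e.

Lemma dot_gt0 v : v != 0 -> 0 < dot v v.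
Proof. exact: neq0_dnorm_gt0. Qed.

Lemma dotZl c u v : dot (c *: u) v = c * dot u v.
Proof. exact: (linearZl_LR dot). Qed.

Lemma cartanD e u v : cartan e (u + v) = cartan e u + cartan e v.
Proof. by rewrite /cartan linearDl mulrDr mulrDl. Qed.

Lemma cartanN e v : cartan e (- v) = - cartan e v.
Proof. by rewrite /cartan linearNl mulrN mulNr. Qed.

Lemma cartanZ e c v : cartan e (c *: v) = c * cartan e v.
Proof. by rewrite /cartan dotZl; ring. Qed.

Lemma cartan_sum e (s : seq V) (F : V -> V) :
  cartan e (\sum_(f <- s) F f) = \sum_(f <- s) cartan e (F f).
Proof.
elim: s => [|f s IH]; first by rewrite !big_nil /cartan linear0l mulr0 mul0r.
by rewrite !big_cons cartanD IH.
Qed.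

Lemma cartan_self e : e != 0 -> cartan e e = 2.
Proof. by move=> /dot_gt0 e0; rewrite /cartan mulfK // gt_eqF. Qed.

Lemma dot_cartan e v : e != 0 -> dot v e = cartan e v * (dot e e / 2).
Proof. by move=> /dot_gt0 e0; rewrite /cartan; field; rewrite gt_eqF. Qed.

Lemma cartan_lt0 e v : e != 0 -> (cartan e v < 0) = (dot v e < 0).
Proof.
by move=> e0; rewrite (dot_cartan v e0) [RHS]pmulr_llt0 // divr_gt0 ?dot_gt0.
Qed.

Lemma reflectionE e v : reflection dot e v = v - cartan e v *: e.
Proof. by []. Qed.

Lemma cartan_reflection e v : e != 0 ->
  cartan e (reflection dot e v) = - cartan e v.
Proof.
by move=> e0; rewrite reflectionE cartanD cartanN cartanZ cartan_self //; ring.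
Qed.

Lemma reflectionK e : e != 0 -> involutive (reflection dot e).
Proof.
move=> e0 v; rewrite reflectionE cartan_reflection // scaleNr opprK.
by rewrite reflectionE subrK.
Qed.

Lemma reflectionN e v : reflection dot e (- v) = - reflection dot e v.
Proof. by rewrite !reflectionE cartanN scaleNr opprD. Qed.

Lemma reflection_self e : e != 0 -> reflection dot e e = - e.
Proof.
move=> e0; rewrite reflectionE cartan_self // scaler_nat mulr2n opprD addrA.
by rewrite subrr add0r.
Qed.

(** * Sums of two roots *)

Section Roots.

Variable Phi : {fset V}.
Hypothesis hPhi : root_system dot Phi.

Lemma root_neq0 e : e \in Phi -> e != 0.
Proof. by case: hPhi => _ n0 _ _ _ ePhi; apply: contraNneq n0 => <-. Qed.

Lemma root_reflection e f : e \in Phi -> f \in Phi ->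
  reflection dot e f \in Phi.
Proof. by case: hPhi => _ _ + _ _; apply. Qed.

Lemma root_opp e : e \in Phi -> - e \in Phi.
Proof.
by move=> ePhi; rewrite -reflection_self ?root_neq0 // root_reflection.
Qed.

Lemma cartan_int e f : e \in Phi -> f \in Phi -> cartan e f \is a Num.int.
Proof. by case: hPhi => _ _ _ + _; apply. Qed.

Lemma root_proportional e c : e \in Phi -> c *: e \in Phi -> c = 1 \/ c = -1.
Proof. by case: hPhi => _ _ _ _; apply. Qed.

(** Excludes the degenerate exchanges in which the two summands of a root would coincide. *)
Lemma double_notin_root e : e \in Phi -> e + e \notin Phi.
Proof.
move=> ePhi; apply/negP; rewrite -mulr2n -scaler_nat.
by move=> /(root_proportional ePhi)[]; lra.
Qed.

Lemma cartan_ltN1 e f : e \in Phi -> f \in Phi -> dot f e < 0 ->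
  cartan e f != -1 -> dot f e <= - dot e e.
Proof.
move=> ePhi fPhi; have e0 := root_neq0 ePhi; rewrite -cartan_lt0 //.
have /intrP[m mE] := cartan_int ePhi fPhi; rewrite mE ltrz0 => m0.
have -> : -1 = (-1)%:~R :> R by [].
rewrite eqr_int => m1.
have : m%:~R <= (-2)%:~R :> R by rewrite ler_int; lia.
rewrite (dot_cartan f e0) mE => m2; have := dot_gt0 e0; nra.
Qed.

(* If neither Cartan integer of the pair is -1, both are at most -2 and then
   |f + e|^2 <= 0. *)
Lemma root_add e f : e \in Phi -> f \in Phi -> dot f e < 0 -> f != - e ->
  f + e \in Phi.
Proof.
move=> ePhi fPhi fe0 fNe.
have [m1|m1] := eqVneq (cartan e f) (-1).
  have := root_reflection ePhi fPhi.
  by rewrite reflectionE m1 scaleN1r opprK.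
have [n1|n1] := eqVneq (cartan f e) (-1).
  have := root_reflection fPhi ePhi.
  by rewrite reflectionE n1 scaleN1r opprK addrC.
have : 0 < dot (f + e) (f + e) by apply: dot_gt0; rewrite addr_eq0.
have ef0 : dot e f < 0 by rewrite dotC.
have := cartan_ltN1 ePhi fPhi fe0 m1; have := cartan_ltN1 fPhi ePhi ef0 n1.
rewrite linearDl !linearDr /= (dotC e f); lra.
Qed.

(** * Functions nondecreasing along e-strings *)

Section Strings.

Variables (e : V) (eps : V -> R).
Hypothesis ePhi : e \in Phi.
Hypothesis eps_mono : forall f, f \in Phi -> f + e \in Phi ->
  eps f <= eps (f + e).
Hypothesis eps_e : eps (- e) < eps e.

(** If the pairing is -k, then r_e f = f + k e lies k steps up the e-string of f. The induction on k
    climbs one step from each end, replacing f by f + e and k by k - 2. *)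
Lemma mono_reflection f : f \in Phi -> cartan e f <= 0 ->
  eps f <= eps (reflection dot e f).
Proof.
move=> fPhi fe0; have e0 := root_neq0 ePhi.
have /intrP[m mE] := cartan_int ePhi fPhi.
have [k kE] : exists k : nat, cartan e f = - k%:R.
  exists `|m|%N; move: fe0; rewrite mE lerz0 => m0.
  by rewrite natr_absz ler0_norm // mulrNz opprK.
elim/ltn_ind: k f fPhi kE {m mE fe0} => -[|k] IH f fPhi kE.
  by rewrite reflectionE kE oppr0 scale0r subr0.
(* The passage from - e to e goes through 0, which is not a root; [eps_e] bridges this gap. *)
have [->|fNe] := eqVneq f (- e).
  by rewrite reflectionN reflection_self // opprK ltW.
have fePhi : f + e \in Phi.
  by apply: root_add => //; rewrite -cartan_lt0 // kE oppr_lt0 ltr0n.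
have rfPhi := root_reflection ePhi fPhi.
case: k => [|k] in IH kE *.
  by rewrite reflectionE kE scaleN1r opprK eps_mono.
(* The chain is eps f <= eps (f + e) <= eps (r_e (f + e)) <= eps (r_e f), the last step because r_e
   (f + e) + e = r_e f. *)
apply: le_trans (eps_mono fPhi fePhi) _.
have rfeE : reflection dot e (f + e) + e = reflection dot e f.
  rewrite !reflectionE cartanD cartan_self // scalerDl scaler_nat mulr2n.
  by rewrite !opprD !addrA subrK [LHS]addrAC addrK.
apply: le_trans (IH k _ (f + e) fePhi _) _ => //.
  by rewrite cartanD cartan_self // kE -[k.+2]addn2 natrD; ring.
by rewrite -[in leRHS]rfeE eps_mono ?rfeE // root_reflection.
Qed.

(** Reindexing one of two copies of the sum by r_e turns each term into (eps f - eps (r_e f)) <f,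
    e^vee>, whose factors never have opposite signs; the term of e is 2 (eps e - eps (- e)) > 0. *)
Lemma sum_mono_gt0 : 0 < \sum_(f <- Phi) eps f * cartan e f.
Proof.
have e0 := root_neq0 ePhi.
have ref (f : V) : f \in Phi -> reflection dot e f \in Phi.
  exact: root_reflection.
set S := (X in 0 < X).
have SE : S + S =
    \sum_(f <- Phi) (eps f - eps (reflection dot e f)) * cartan e f.
  rewrite {2}/S -(sum_reindex_involution ref); last first.
    by move=> f _; exact: reflectionK.
  rewrite -big_split /=; apply: eq_bigr => f _.
  by rewrite cartan_reflection //; ring.
have term_ge0 f : f \in Phi ->
    0 <= (eps f - eps (reflection dot e f)) * cartan e f.
  move=> fPhi; have [fe0|fe0] := leP (cartan e f) 0.
    by rewrite mulr_le0 // subr_le0 mono_reflection.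
  rewrite mulr_ge0 ?(ltW fe0) // subr_ge0.
  rewrite -[in leRHS](reflectionK e0 f) mono_reflection ?ref //.
  by rewrite cartan_reflection // oppr_le0 ltW.
have : 0 < S + S; last lra.
rewrite SE (big_fsetD1 e) //= ltr_pwDl //.
  by rewrite reflection_self // cartan_self // mulr_gt0 // subr_gt0.
by rewrite big_seq sumr_ge0 // => f; rewrite !inE => /andP[_ /term_ge0].
Qed.

End Strings.

(** * Positive roots and integrality of the index *)

Section PositiveSystem.

Variable Rp : {fset V}.
Hypothesis hRp : positive_system Phi Rp.

Lemma positive_root f : f \in Rp -> f \in Phi.
Proof. by case: hRp => /fsubsetP + _ _; apply. Qed.

Lemma positive_oppE f : f \in Phi -> (- f \in Rp) = (f \notin Rp).
Proof.
by case: hRp => _ + _ => /[apply]; case: (f \in Rp) (- f \in Rp) => [][].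
Qed.

Lemma positive_add a b : a \in Rp -> b \in Rp -> a + b \in Phi -> a + b \in Rp.
Proof. by case: hRp => _ _; apply. Qed.

Lemma sum_roots_even (F : V -> R) : (forall f, F (- f) = F f) ->
  \sum_(f <- Phi) F f = 2 * \sum_(f <- Rp) F f.
Proof.
move=> FN; rewrite (big_fsetID _ (mem Rp)) /=.
have -> : [fset x in Phi | x \in Rp]%fset = Rp.
  apply/fsetP => x; rewrite !inE andb_idl //; exact: positive_root.
have -> : \sum_(f <- [fset x in Phi | x \notin Rp]%fset) F f =
    \sum_(f <- map -%R Rp) F f.
  apply: perm_big; apply: uniq_perm => [||x]; first exact: fset_uniq.
    by rewrite map_inj_uniq ?fset_uniq //; exact: oppr_inj.
  rewrite -[x in RHS]opprK (mem_map oppr_inj) !inE.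
  apply/andP/idP => [[xPhi]|nxRp]; first by rewrite positive_oppE.
  have nxPhi := positive_root nxRp.
  by rewrite -[x]opprK root_opp //= positive_oppE ?negbK.
by rewrite big_map mulr_natl mulr2n; congr (_ + _); apply: eq_bigr => f _.
Qed.

(* The involution is f |-> |r_e f|, the one of r_e f and - r_e f lying in Rp;
   it changes the Cartan integer of f at most by a sign. *)
Lemma cartan_rho_int e : e \in Rp -> cartan e (rho Rp) \is a Num.int.
Proof.
move=> eRp; have ePhi := positive_root eRp; have e0 := root_neq0 ePhi.
rewrite /rho cartanZ (cartan_sum _ _ id) mulr_sumr.
pose r := reflection dot e.
pose h f := if r f \in Rp then r f else - r f.
have rPhi f : f \in Rp -> r f \in Phi.
  by move=> /positive_root; exact: root_reflection.
have half c : 2^-1 * c + 2^-1 * c = c :> R by field.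
apply: (@sum_involution_int _ _ h) => f fRp; have fPhi := positive_root fRp.
- rewrite /h; case: ifPn => // /negbTE rf.
  by rewrite positive_oppE ?rf // rPhi.
- rewrite /h; case: (boolP (r f \in Rp)) => _.
    by rewrite /r reflectionK // fRp.
  by rewrite /r reflectionN reflectionK // positive_oppE // fRp opprK.
- rewrite /h; case: ifPn => _; rewrite ?cartanN cartan_reflection //.
    by rewrite mulrN subrr.
  by rewrite opprK half cartan_int.
- rewrite /h; case: ifPn => _ rf.
    have := cartan_reflection f e0; rewrite -/r rf => cN.
    by rewrite (_ : cartan e f = 0) ?mulr0 //; lra.
  (* Here r_e f = - f, so f is a multiple of e; the coefficient is the summand itself, and
     reducedness makes it 1 or -1. *)
  have fE : f = (2^-1 * cartan e f) *: e.
    move: rf; rewrite /r reflectionE opprB => /(canRL (subrK _)) cE.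
    rewrite -scalerA cE -mulr2n -scaler_nat scalerA.
    by rewrite mulVf ?scale1r ?pnatr_eq0.
  have := fPhi; rewrite {1}fE => /(root_proportional ePhi)[] ->;
    by rewrite ?rpredN rpred1.
Qed.

Lemma cartan_weight_int e (s : {fset V}) : e \in Rp -> (s `<=` Rp)%fset ->
  cartan e (weight Rp s) \is a Num.int.
Proof.
move=> eRp /fsubsetP sRp.
rewrite /weight cartanD cartanN rpredB ?cartan_rho_int //.
rewrite (cartan_sum _ _ id) big_seq rpred_sum // => f /sRp fRp.
by rewrite cartan_int // positive_root.
Qed.

(** Integrality of the pairing supplies a witness for [xget], so the default is not taken. Sign
    conditions on the index thus become opposite ones on [cartan]. *)
Lemma root_indexE e (s : {fset V}) : e \in Rp -> (s `<=` Rp)%fset ->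
  (root_index dot e (weight Rp s))%:~R = - cartan e (weight Rp s).
Proof.
move=> eRp sRp; set a := weight Rp s.
have e0 := root_neq0 (positive_root eRp).
have raE : reflection dot e a - a = - cartan e a *: e.
  by rewrite reflectionE addrAC subrr add0r scaleNr.
have /intrP[m mE] := cartan_weight_int eRp sRp.
have /xgetPex : exists r : int, reflection dot e a - a = r%:~R *: e.
  by exists (- m); rewrite raE mE mulrNz.
move=> /(_ 0) /=; rewrite -/(root_index dot e a) raE => /esym /eqP.
by rewrite -subr_eq0 -scalerBl scaler_eq0 (negbTE e0) orbF subr_eq0 => /eqP.
Qed.

(** * Edges that bring e into a vertex *)

Lemma weight_exchange (s t : {fset V}) :
  \sum_(f <- (s `\` t)%fset) f = \sum_(f <- (t `\` s)%fset) f ->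
  weight Rp s = weight Rp t.
Proof.
have split (a b : {fset V}) : \sum_(f <- a) f =
    \sum_(f <- (a `&` b)%fset) f + \sum_(f <- (a `\` b)%fset) f.
  rewrite (big_fsetID _ (mem b)) /=; congr (_ + _); apply: perm_big.
    by apply: uniq_perm => [||x]; rewrite ?fset_uniq // !inE.
  by apply: uniq_perm => [||x]; rewrite ?fset_uniq // !inE andbC.
by move=> st; rewrite /weight (split s t) (split t s) fsetIC st.
Qed.

Lemma sum_fset2 (a b : V) : a != b -> \sum_(f <- [fset a; b]%fset) f = a + b.
Proof. by move=> ab; rewrite big_fsetU1 ?big_seq_fset1 // inE. Qed.

Definition exchange_to (e : V) (s t : {fset V}) : Prop :=
  [/\ e \in t, weight Rp t = weight Rp s & edge (basis_graph Rp) s t].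

(** The root a + e of s is replaced by a and e; a != e keeps these a genuine pair with sum a + e. *)
Lemma exchange_split e a (s : {fset V}) : (s `<=` Rp)%fset ->
    e \in Rp -> a \in Rp -> e \notin s -> a \notin s -> a + e \in s -> a != e ->
  exists t, exchange_to e s t.
Proof.
move=> sRp eRp aRp es as_ aes ae; have aeRp := fsubsetP sRp _ aes.
have aea : a != a + e.
  by apply: contraNneq as_ => ->.
have aee : e != a + e by apply: contraNneq es => ->.
exists ([fset a; e] `|` (s `\ (a + e)%R))%fset.
set t := (X in exchange_to _ _ X).
have stE : (s `\` t = [fset (a + e)%R])%fset.
  apply/fsetP => x; rewrite !inE.
  have [->|xae] /= := eqVneq x (a + e).
    by rewrite aes !(eq_sym (a + e)) (negbTE aea) (negbTE aee).
  by case: (x \in s); rewrite ?andbF // orbT.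
have tsE : (t `\` s = [fset a; e])%fset.
  apply/fsetP => x; rewrite !inE; case: (boolP (x \in s)) => xs /=.
    apply/esym/norP.
    by split; [apply: contraNneq as_|apply: contraNneq es] => <-.
  by rewrite andbF orbF.
split.
- by rewrite !inE eqxx orbT.
- by apply/esym/weight_exchange; rewrite stE tsE sum_fset2 ?big_seq_fset1.
split=> //.
  apply/fsubsetP => x; rewrite !inE => /orP[/orP[]/eqP->//|/andP[_]].
  exact: (fsubsetP sRp).
by exists (a + e), a, e; split=> //; left.
Qed.

(** The roots a and b of s are replaced by their sum e. *)
Lemma exchange_merge e a b (s : {fset V}) : (s `<=` Rp)%fset ->
    e \in Rp -> e \notin s -> a \in s -> b \in s -> e = a + b -> a != b ->
  exists t, exchange_to e s t.
Proof.
move=> sRp eRp es as_ bs eE ab.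
exists (e |` (s `\` [fset a; b]))%fset.
set t := (X in exchange_to _ _ X).
have stE : (s `\` t = [fset a; b])%fset.
  apply/fsetP => x; rewrite !inE negb_or negb_and negbK.
  case: (boolP (x \in s)) => xs; rewrite ?andbF ?andbT ?orbF.
    by rewrite andb_idl // => _; apply: contraNneq es => <-.
  by apply/esym/norP; split; apply: contraNneq xs => ->.
have tsE : (t `\` s = [fset e])%fset.
  apply/fsetP => x; rewrite !inE.
  have [->|xe] /= := eqVneq x e; first by rewrite es.
  by case: (x \in s); rewrite ?andbF.
split.
- by rewrite !inE eqxx.
- by apply/esym/weight_exchange; rewrite stE tsE sum_fset2 ?big_seq_fset1.
split=> //.
  apply/fsubsetP => x; rewrite !inE => /orP[/eqP->//|/andP[_]].
  exact: (fsubsetP sRp).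
by exists e, a, b; split=> //; [exact: (fsubsetP sRp)..|right].
Qed.

(** * The sign function of a vertex and the existence of exchanges *)

Definition sign (s : {fset V}) (f : V) : R :=
  if f \in Rp then (-1) ^+ (f \in s) else - (-1) ^+ (- f \in s).

Lemma signN s f : f \in Phi -> sign s (- f) = - sign s f.
Proof.
move=> fPhi; rewrite /sign positive_oppE // opprK.
by case: (f \in Rp); rewrite ?opprK.
Qed.

(** One factor 2 arises because f and - f contribute equally, the other because the sum of
    [sign s f] times f over [Rp] is twice the weight. *)
Lemma cartan_weight e (s : {fset V}) : (s `<=` Rp)%fset ->
  4 * cartan e (weight Rp s) = \sum_(f <- Phi) sign s f * cartan e f.
Proof.
(* [sign] is known to be odd only on roots; cutting off outside [Phi] makes the summand even on all
   of V, as [sum_roots_even] requires. *)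
move=> sRp; pose F f := if f \in Phi then sign s f * cartan e f else 0.
have -> : \sum_(f <- Phi) sign s f * cartan e f = \sum_(f <- Phi) F f.
  by apply: eq_big_seq => f fPhi; rewrite /F fPhi.
have PhiN f : (- f \in Phi) = (f \in Phi).
  by apply/idP/idP => /root_opp //; rewrite opprK.
rewrite sum_roots_even; last first.
  move=> f; rewrite /F PhiN; case: ifP => // fPhi.
  by rewrite signN // cartanN mulrNN.
have -> : \sum_(f <- Rp) F f =
    \sum_(f <- Rp) (cartan e f - 2 * (if f \in s then cartan e f else 0)).
  apply: eq_big_seq => f fRp; rewrite /F (positive_root fRp) /sign fRp.
  by case: (f \in s) => /=; ring.
rewrite sumrB -mulr_sumr /weight cartanD cartanN /rho cartanZ.
rewrite !(cartan_sum _ _ id) /=.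
have -> : \sum_(f <- Rp) (if f \in s then cartan e f else 0) =
    \sum_(f <- s) cartan e f.
  rewrite -(big_fset_incl _ sRp) /=.
    by apply: eq_big_seq => f ->.
  by move=> f _ /negbTE ->.
by field.
Qed.

Lemma exists_exchange e (s : {fset V}) : (s `<=` Rp)%fset -> e \in Rp ->
  e \notin s -> cartan e (weight Rp s) <= 0 -> exists t, exchange_to e s t.
Proof.
move=> sRp eRp es we; have ePhi := positive_root eRp.
apply: contrapT => nt.
have : 0 < \sum_(f <- Phi) sign s f * cartan e f; last first.
  by rewrite -cartan_weight //; lra.
apply: sum_mono_gt0 => //; last first.
  by rewrite signN // /sign eRp (negbTE es) /=; lra.
move=> f fPhi fePhi; rewrite /sign.
have feN : - (f + e) + e = - f by rewrite opprD subrK.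
(* Monotonicity can fail only with eps f = 1 and eps (f + e) = -1. For f positive, so is f + e, and
   it lies in s while f does not: split f + e. *)
case: (boolP (f \in Rp)) => fRp.
  rewrite positive_add //.
  case: (boolP (f \in s)) => fs; case: (boolP (f + e \in s)) => fes /=; try lra.
  case: nt; apply: (@exchange_split e f) => //.
  by apply: contraTneq fePhi => ->; exact: double_notin_root.
have NfRp : - f \in Rp by rewrite positive_oppE.
(* For f negative and f + e positive, a failure puts both - f and f + e in s, and they merge into
   e. *)
case: (boolP (f + e \in Rp)) => feRp.
  case: (boolP (- f \in s)) => fs;
    case: (boolP (f + e \in s)) => fes /=; try lra.
  case: nt; apply: (@exchange_merge e (f + e) (- f)) => //.
    by rewrite addrAC subrr add0r.
  apply: contraTneq (positive_root eRp) => fE.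
  have -> : e = - f + - f by rewrite -[X in X + _]fE addrAC subrr add0r.
  by apply: double_notin_root; exact: root_opp.
(* With both negative, a failure puts - f in s but not - (f + e): split - f as - (f + e) + e. *)
have NfeRp : - (f + e) \in Rp by rewrite positive_oppE.
case: (boolP (- f \in s)) => fs;
  case: (boolP (- (f + e) \in s)) => fes /=; try lra.
case: nt; apply: (@exchange_split e (- (f + e))) => //; rewrite ?feN //.
apply: contraTneq (root_opp fPhi) => fE.
by rewrite -feN fE double_notin_root.
Qed.

(** The sums over s and over its complement add up to 2 rho. *)
Lemma weightC (s : {fset V}) : (s `<=` Rp)%fset ->
  weight Rp (Rp `\` s)%fset = - weight Rp s.
Proof.
move=> sRp; rewrite /weight /rho.
have -> : \sum_(f <- Rp) f =
    \sum_(f <- s) f + \sum_(f <- (Rp `\` s)%fset) f.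
  rewrite (big_fsetID _ (mem s)) /=; congr (_ + _); apply: perm_big.
    apply: uniq_perm => [||x]; rewrite ?fset_uniq // !inE andb_idl //.
    exact: (fsubsetP sRp).
  by apply: uniq_perm => [||x]; rewrite ?fset_uniq // !inE andbC.
set a := \sum_(f <- s) f; set b := \sum_(f <- _) f.
apply/eqP; rewrite -addr_eq0 addrACA -scalerDl -opprD (addrC b).
by rewrite (_ : 2^-1 + 2^-1 = 1) ?scale1r ?subrr //; field.
Qed.

Lemma exists_exchangeC e (s : {fset V}) : (s `<=` Rp)%fset ->
    e \in s -> 0 <= cartan e (weight Rp s) ->
  exists t, [/\ e \notin t, weight Rp t = weight Rp s &
                edge (basis_graph Rp) s t].
Proof.
move=> sRp es we; have eRp := fsubsetP sRp _ es.
have Dsub (u : {fset V}) : (Rp `\` u `<=` Rp)%fset by exact: fsubsetDl.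
have [||t [et wt [_ tRp tE]]] :=
  @exists_exchange e (Rp `\` s)%fset (Dsub s) eRp.
- by rewrite !inE es.
- by rewrite weightC // cartanN oppr_le0.
exists (Rp `\` t)%fset; split; first by rewrite !inE et.
  by rewrite weightC // wt weightC // opprK.
split=> //; case: tE => a [b [c [aR bR cR abc tE]]].
exists a, b, c; split=> //.
(* Complementing both ends of an edge interchanges the two differences, hence the two alternatives
   in the definition of an edge. *)
have <- : (t `\` (Rp `\` s) = s `\` (Rp `\` t))%fset.
  apply/fsetP => x; rewrite !inE.
  have := fsubsetP sRp x; have := fsubsetP tRp x.
  case: (x \in s) (x \in t) (x \in Rp) => [] [] [] // H1 H2.
    by have := H2 isT.
  by have := H1 isT.
have <- : ((Rp `\` s) `\` t = (Rp `\` t) `\` s)%fset.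
  by apply/fsetP => x; rewrite !inE andbCA.
by case: tE => -[-> ->]; [right|left].
Qed.

End PositiveSystem.
End Roots.
End Reflections.

Theorem theorem4p4 (R : realType) (V : vectType R)
    (dot : {dot V for @idfun R}) (Phi Rp : {fset V})
    (hPhi : root_system dot Phi) (hRp : positive_system Phi Rp)
    (e : V) (he : e \in Rp) (alpha : V) (halpha : alpha \in Omega Rp) :
  (0 <= root_index dot e alpha ->
     vertices (Gamma1 Rp e alpha) <> fset0 /\
     (vertices (Gamma0 Rp e alpha) <> fset0 ->
      forall s, s \in vertices (Gamma0 Rp e alpha) ->
      exists t, t \in vertices (Gamma1 Rp e alpha) /\
                edge (Gamma Rp alpha) s t)) /\
  (root_index dot e alpha <= 0 ->
     vertices (Gamma0 Rp e alpha) <> fset0 /\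
     (vertices (Gamma1 Rp e alpha) <> fset0 ->
      forall s, s \in vertices (Gamma1 Rp e alpha) ->
      exists t, t \in vertices (Gamma0 Rp e alpha) /\
                edge (Gamma Rp alpha) s t)).
Proof.
have in1 u : u \in vertices (Gamma1 Rp e alpha) =
    [&& (u `<=` Rp)%fset, weight Rp u == alpha & e \in u].
  by rewrite !inE fpowersetE -andbA.
have in0 u : u \in vertices (Gamma0 Rp e alpha) =
    [&& (u `<=` Rp)%fset, weight Rp u == alpha & e \notin u].
  by rewrite !inE fpowersetE -andbA.
have nonempty (X : {fset {fset V}}) u : u \in X -> X <> fset0.
  by move=> uX X0; rewrite X0 inE in uX.
case/imfsetP: halpha => s /=; rewrite fpowersetE => sRp alphaE.
have rE := root_indexE hPhi hRp he sRp; rewrite -alphaE in rE.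
split=> r0.
- have c0 : cartan dot e alpha <= 0 by rewrite -oppr_ge0 -rE ler0z.
  have step u : u \in vertices (Gamma0 Rp e alpha) ->
      exists t, t \in vertices (Gamma1 Rp e alpha) /\ edge (Gamma Rp alpha) u t.
    rewrite in0 => /and3P[uRp /eqP uE eu].
    have [|t [et wt ut]] := exists_exchange hPhi hRp uRp he eu.
      by rewrite uE.
    exists t; rewrite in1 wt uE eqxx et; case: (ut) => _ tRp _.
    by rewrite tRp; split=> //; split; rewrite ?wt ?uE.
  split=> //.
  (* The vertex s realising alpha either contains e already or is moved by [step] to one that
     does. *)
  have [es|es] := boolP (e \in s).
    by apply: (nonempty _ s); rewrite in1 sRp -alphaE eqxx.
  have [|t [tG _]] := step s; first by rewrite in0 sRp -alphaE eqxx.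
  exact: nonempty tG.
- have c0 : 0 <= cartan dot e alpha by rewrite -oppr_le0 -rE lerz0.
  have step u : u \in vertices (Gamma1 Rp e alpha) ->
      exists t, t \in vertices (Gamma0 Rp e alpha) /\ edge (Gamma Rp alpha) u t.
    rewrite in1 => /and3P[uRp /eqP uE eu].
    have [|t [et wt ut]] := exists_exchangeC hPhi hRp uRp eu.
      by rewrite uE.
    exists t; rewrite in0 wt uE eqxx et; case: (ut) => _ tRp _.
    by rewrite tRp; split=> //; split; rewrite ?wt ?uE.
  split=> //.
  have [es|es] := boolP (e \in s); last first.
    by apply: (nonempty _ s); rewrite in0 sRp -alphaE eqxx.
  have [|t [tG _]] := step s; first by rewrite in1 sRp -alphaE eqxx.
  exact: nonempty tG.
Qed.
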